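(* Let $\tau_A:A\to M$ be a Lie affgebroid modelled on $\tau_V:V\to M$. If $h:V^*\to A^+$ is a hyperregular Hamiltonian section then there exists a hyperregular Lagrangian function $L:A\to\mathbb R$ such that the Hamiltonian section associated with $L$ is just $h$; in other words, $h_L=h$.
   Context: Everything is smooth. $\tau_A:A\to M$ is an affine bundle modelled on the vector bundle $\tau_V:V\to M$ carrying a Lie affgebroid structure, i.e. a Lie bracket $[\cdot,\cdot]_V$ on $\Gamma(V)$, an $\mathbb R$-linear action $D:\Gamma(A)\times\Gamma(V)\to\Gamma(V)$ and an affine map $\rho_A:A\to TM$ with $D_X[\bar Y,\bar Z]_V=[D_X\bar Y,\bar Z]_V+[\bar Y,D_X\bar Z]_V$, $D_{X+\bar Y}\bar Z=D_X\bar Z+[\bar Y,\bar Z]_V$, $D_X(f\bar Y)=fD_X\bar Y+\rho_A(X)(f)\bar Y$. $A^+=\mathrm{Aff}(A,\mathbb R)\to M$ is the vector bundle whose fibre at $x$ is the space of affine functions on $A_x$; $\tau_V^*:V^*\to M$ is the dual of $V$; $\mu:A^+\to V^*$ sends an affine function to its linear part. A Hamiltonian section is a section $h:V^*\to A^+$ of $\mu$. **Hyperregular Hamiltonian sections.** Given a section $\mathcal R$ of $A$, let $H_{\mathcal R}:V^*\to\mathbb R$, $H_{\mathcal R}(\alpha)=h(\alpha)(\mathcal R(\tau_V^*(\alpha)))$, and define $(\mathbb Fh)_{\mathcal R}:V^*\to V$ by $(\mathbb Fh)_{\mathcal R}(\alpha)\in V_x$ and $\beta((\mathbb Fh)_{\mathcal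 R}(\alpha))=\frac{d}{dt}\big|_{t=0}H_{\mathcal R}(\alpha+t\beta)$ for $\alpha,\beta\in V_x^*$. The map $\mathbb Fh:V^*\to A$, $\mathbb Fh(\alpha)=\mathcal R(\tau_V^*(\alpha))-(\mathbb Fh)_{\mathcal R}(\alpha)$, does not depend on $\mathcal R$; in adapted local coordinates, if $h(x^i,y_\alpha)=(x^i,-H(x^j,y_\beta),y_\alpha)$ then $\mathbb Fh(x^i,y_\alpha)=(x^i,\partial H/\partial y_\alpha)$. $h$ is hyperregular if $\mathbb Fh$ is a global diffeomorphism. **Hyperregular Lagrangians.** For $L:A\to\mathbb R$, the extended Legendre transformation $Leg_L:A\to A^+$ is $Leg_L(a)(b)=L(a)+\frac{d}{dt}\big|_{t=0}L(a+t(b-a))$ for $a,b\in A_x$, locally $Leg_L(x^i,y^\alpha)=(x^i,L-\frac{\partial L}{\partial y^\alpha}y^\alpha,\frac{\partial L}{\partial y^\alpha})$; the Legendre transformation is $leg_L=\mu\circ Leg_L:A\to V^*$. $L$ is hyperregular if $leg_L$ is a global diffeomorphism, and then the Hamiltonian section associated with $L$ is $h_L=Leg_L\circ leg_L^{-1}$. *)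

(* Defs.v *)
From HB Require Import structures.
From mathcomp Require Import all_boot all_order all_algebra.
From mathcomp Require Import all_classical all_reals all_analysis.
Set Implicit Arguments.
Unset Strict Implicit.
Unset Printing Implicit Defensive.
Import Order.TTheory GRing.Theory Num.Theory.
Import numFieldNormedType.Exports.
Local Open Scope classical_set_scope.
Local Open Scope ring_scope.

(* All model spaces below are finite-dimensional.  There, f is C^{k+1} on the
   open set U iff it is differentiable on U and all its directional
   derivatives are C^k on U. *)
Fixpoint Ck (R : realType) (E F : normedModType R) (k : nat) (U : set E)
    (f : E -> F) : Prop :=
  match k with
  | 0%N => forall u, U u -> {for u, continuous f}
  | k'.+1 => (forall u, U u -> differentiable f u) /\
             (forall v : E, Ck k' U (fun u => 'D_v f u))
  end.

Definition Cinf (R : realType) (E F : normedModType R) (U : set E)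
    (f : E -> F) : Prop :=
  forall k, Ck k U f.

(* A family of charts, with values in the model space E; [ch_map i] is
   meaningful on [ch_dom i] only. *)
Record charts (R : realType) (X : Type) (E : normedModType R) := Charts {
  ch_idx : Type;
  ch_dom : ch_idx -> set X;
  ch_map : ch_idx -> X -> E }.

(* The transition map ch_map j \o (ch_map i)^-1 is represented by any function
   agreeing with it on its domain, the image of the overlap. *)
Definition is_atlas (R : realType) (X : Type) (E : normedModType R)
    (C : charts X E) : Prop :=
  [/\ forall x, exists i : ch_idx C, ch_dom i x,
      forall i : ch_idx C, set_inj (ch_dom i) (ch_map i),
      forall i j : ch_idx C, open (ch_map i @` (ch_dom i `&` ch_dom j)) &
      forall i j : ch_idx C, exists T : E -> E,
        Cinf (ch_map i @` (ch_dom i `&` ch_dom j)) T /\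
        forall x, ch_dom i x -> ch_dom j x -> T (ch_map i x) = ch_map j x].

(* f is smooth on a neighbourhood of x; phi is its coordinate expression
   ch_map j \o f \o (ch_map i)^-1. *)
Definition smooth_at (R : realType) (X Y : Type) (E F : normedModType R)
    (C : charts X E) (C' : charts Y F) (f : X -> Y) (x : X) : Prop :=
  exists (i : ch_idx C) (j : ch_idx C') (O : set E) (phi : E -> F),
    [/\ ch_dom i x,
        open O /\ O (ch_map i x),
        O `<=` ch_map i @` ch_dom i,
        Cinf O phi &
        forall y, ch_dom i y -> O (ch_map i y) ->
          ch_dom j (f y) /\ ch_map j (f y) = phi (ch_map i y)].

Definition smooth (R : realType) (X Y : Type) (E F : normedModType R)
    (C : charts X E) (C' : charts Y F) (f : X -> Y) : Prop :=
  forall x, smooth_at C C' f x.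

Definition diffeomorphism (R : realType) (X Y : Type) (E F : normedModType R)
    (C : charts X E) (C' : charts Y F) (f : X -> Y) : Prop :=
  exists g : Y -> X,
    [/\ cancel f g, cancel g f, smooth C C' f & smooth C' C g].

Definition real_charts (R : realType) : charts R R^o :=
  {| ch_idx := unit; ch_dom := fun _ => setT; ch_map := fun _ => id |}.

Record manifold (R : realType) (m : nat) := Manifold {
  mf_space :> topologicalType;
  mf_charts : charts mf_space 'rV[R]_m;
  mf_hausdorff : hausdorff_space mf_space;
  mf_second_countable : @second_countable mf_space;
  mf_atlas : is_atlas mf_charts;
  (* the charts are homeomorphisms from open sets onto their images *)
  mf_dom_open : forall i : ch_idx mf_charts, open (ch_dom i);
  mf_homeo : forall (i : ch_idx mf_charts) (W : set mf_space),
    W `<=` ch_dom i -> (open W <-> open (ch_map i @` W)) }.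

Definition smooth_fun_at (R : realType) (m : nat) (M : manifold R m)
    (f : M -> R) (x : M) : Prop :=
  smooth_at (mf_charts M) (real_charts R) f x.

Definition smooth_fun (R : realType) (m : nat) (M : manifold R m)
    (f : M -> R) : Prop :=
  smooth (mf_charts M) (real_charts R) f.

(* A bundle is a family of fibres over M; its total space is the sigma type
   {x : M & E x}, with charts given by charts of M and fibre coordinates
   [y j x], defined for x in [W j]. *)

Definition total_charts (R : realType) (m : nat) (M : manifold R m)
    (E : M -> Type) (F : normedModType R) (J : Type) (W : J -> set M)
    (y : forall (j : J) (x : M), E x -> F) :
    charts {x : M & E x} ('rV[R]_m * F)%type :=
  {| ch_idx := (ch_idx (mf_charts M) * J)%type;
     ch_dom := fun p => [set e | ch_dom p.1 (tag e) /\ W p.2 (tag e)];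
     ch_map := fun p e => (ch_map p.1 (tag e), y p.2 (tag e) (tagged e)) |}.

Definition tot (M : Type) (E E' : M -> Type) (f : forall x, E x -> E' x)
    (e : {x : M & E x}) : {x : M & E' x} :=
  existT E' (tag e) (f (tag e) (tagged e)).

Definition smooth_section (R : realType) (m : nat) (M : manifold R m)
    (E : M -> Type) (F : normedModType R) (C : charts {x : M & E x} F)
    (s : forall x, E x) : Prop :=
  smooth (mf_charts M) C (fun x => existT E x (s x)).

(* Local trivialisations of a vector bundle are given by local frames. *)
Definition frame_coord (R : realType) (k : nat) (V : vectType R)
    (e : k.-tuple V) (v : V) : 'rV[R]_k :=
  \row_l coord e l v.

Record vector_bundle (R : realType) (m : nat) (M : manifold R m) (k : nat) :=
  VectorBundle {
  vb_fibre :> M -> vectType R;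
  vb_idx : Type;
  vb_dom : vb_idx -> set M;
  vb_frame : vb_idx -> forall x, k.-tuple (vb_fibre x);
  vb_dom_open : forall j, open (vb_dom j);
  vb_cover : forall x, exists j, vb_dom j x;
  vb_basis : forall j x, vb_dom j x -> basis_of fullv (vb_frame j x);
  vb_atlas : is_atlas
    (@total_charts R m M (fun x => vb_fibre x : Type) 'rV[R]_k vb_idx vb_dom
       (fun j x => frame_coord (vb_frame j x))) }.

Definition vb_charts (R : realType) (m : nat) (M : manifold R m) (k : nat)
    (V : vector_bundle M k) :
    charts {x : M & V x} ('rV[R]_m * 'rV[R]_k)%type :=
  @total_charts R m M (fun x => V x : Type) 'rV[R]_k (vb_idx V) (@vb_dom _ _ _ _ V)
    (fun j x => frame_coord (vb_frame j x)).

Definition dual (R : realType) (m : nat) (M : manifold R m) (k : nat)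
    (V : vector_bundle M k) (x : M) : vectType R :=
  'Hom(V x, R^o).

(* Coordinates with respect to the dual frames. *)
Definition dual_charts (R : realType) (m : nat) (M : manifold R m) (k : nat)
    (V : vector_bundle M k) :
    charts {x : M & dual V x} ('rV[R]_m * 'rV[R]_k)%type :=
  @total_charts R m M (fun x => dual V x : Type) 'rV[R]_k (vb_idx V) (@vb_dom _ _ _ _ V)
    (fun j x b => \row_l b (tnth (vb_frame j x) l)).

Record affine_space (R : realType) (V : vectType R) := AffineSpace {
  as_point :> Type;
  as_add : as_point -> V -> as_point;
  as_sub : as_point -> as_point -> V;
  as_add0 : forall a, as_add a 0 = a;
  as_addA : forall a v w, as_add (as_add a v) w = as_add a (v + w);
  as_subK : forall a b, as_add a (as_sub b a) = b;
  as_addK : forall a v, as_sub (as_add a v) a = v }.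

(* Local trivialisations are given by a local origin e_0 together with a local
   frame (e_1, ..., e_k) of the model bundle: a = e_0 + sum_l y^l e_l. *)
Record affine_bundle (R : realType) (m : nat) (M : manifold R m) (k : nat)
    (V : vector_bundle M k) := AffineBundle {
  ab_fibre :> forall x : M, affine_space (V x);
  ab_idx : Type;
  ab_dom : ab_idx -> set M;
  ab_frame : ab_idx -> vb_idx V;
  ab_origin : ab_idx -> forall x, ab_fibre x;
  ab_dom_open : forall j, open (ab_dom j);
  ab_dom_sub : forall j, ab_dom j `<=` vb_dom (ab_frame j);
  ab_cover : forall x, exists j, ab_dom j x;
  ab_atlas : is_atlas
    (@total_charts R m M (fun x => ab_fibre x : Type) 'rV[R]_k ab_idx ab_dom
       (fun j x a =>
          frame_coord (vb_frame (ab_frame j) x) (as_sub a (ab_origin j x)))) }.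

Definition ab_charts (R : realType) (m : nat) (M : manifold R m) (k : nat)
    (V : vector_bundle M k) (A : affine_bundle V) :
    charts {x : M & A x} ('rV[R]_m * 'rV[R]_k)%type :=
  @total_charts R m M (fun x => A x : Type) 'rV[R]_k (ab_idx A) (@ab_dom _ _ _ _ _ A)
    (fun j x a =>
       frame_coord (vb_frame (ab_frame j) x) (as_sub a (ab_origin j x))).

(* Real affine functions on an affine space; the linear part is determined by
   the underlying function, affine spaces being nonempty here. *)
Record affine_fun (R : realType) (V : vectType R) (A : affine_space V) :=
  AffineFun {
  af_val :> A -> R;
  af_lin : 'Hom(V, R^o);
  af_affine : forall a v, af_val (as_add a v) = af_val a + af_lin v }.

Definition aplus (R : realType) (m : nat) (M : manifold R m) (k : nat)
    (V : vector_bundle M k) (A : affine_bundle V) (x : M) : Type :=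
  affine_fun (A x).

(* The affine function p_0 + sum_l p_l y^l has coordinates (p_0, (p_l)_l). *)
Definition aplus_charts (R : realType) (m : nat) (M : manifold R m) (k : nat)
    (V : vector_bundle M k) (A : affine_bundle V) :
    charts {x : M & aplus A x} ('rV[R]_m * (R^o * 'rV[R]_k))%type :=
  @total_charts R m M (aplus A) (R^o * 'rV[R]_k)%type (ab_idx A)
    (@ab_dom _ _ _ _ _ A)
    (fun j x p => (p (ab_origin j x),
                   \row_l af_lin p (tnth (vb_frame (ab_frame j) x) l))).

Definition mu (R : realType) (m : nat) (M : manifold R m) (k : nat)
    (V : vector_bundle M k) (A : affine_bundle V) (x : M) (p : aplus A x) :
    dual V x :=
  af_lin p.

(* Derivations at x of the algebra of germs of smooth functions.  [tv_junk]
   fixes the value on the functions which are not smooth near x, so that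
   vectors inducing the same derivation are equal. *)
Record tangent (R : realType) (m : nat) (M : manifold R m) (x : M) :=
  Tangent {
  tv :> (M -> R) -> R;
  tv_germ : forall f g : M -> R, (\forall y \near x, f y = g y) -> tv f = tv g;
  tv_linear : forall (c : R) (f g : M -> R),
    smooth_fun_at f x -> smooth_fun_at g x ->
    tv (fun y => c * f y + g y) = c * tv f + tv g;
  tv_leibniz : forall f g : M -> R,
    smooth_fun_at f x -> smooth_fun_at g x ->
    tv (fun y => f y * g y) = tv f * g x + f x * tv g;
  tv_junk : forall f : M -> R, ~ smooth_fun_at f x -> tv f = 0 }.

(* The fibre coordinates of v are the v(x^l), x^l the coordinate functions. *)
Definition tangent_charts (R : realType) (m : nat) (M : manifold R m) :
    charts {x : M & tangent x} ('rV[R]_m * 'rV[R]_m)%type :=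
  @total_charts R m M (@tangent R m M) 'rV[R]_m (ch_idx (mf_charts M))
    (@ch_dom _ _ _ (mf_charts M))
    (fun i x v => \row_l v (fun y => ch_map i y 0 l)).

(* Brackets and actions are total operations on all sections; their values
   matter on smooth sections only. *)
Record lie_affgebroid (R : realType) (m : nat) (M : manifold R m) (k : nat)
    (V : vector_bundle M k) (A : affine_bundle V) := LieAffgebroid {
  la_bracket : (forall x, V x) -> (forall x, V x) -> (forall x, V x);
  la_D : (forall x, A x) -> (forall x, V x) -> (forall x, V x);
  la_anchor : forall x, A x -> tangent x;
  la_bracket_smooth : forall Y Z,
    smooth_section (vb_charts V) Y -> smooth_section (vb_charts V) Z ->
    smooth_section (vb_charts V) (la_bracket Y Z);
  la_bracket_linear : forall (c : R) Y Y' Z,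
    smooth_section (vb_charts V) Y -> smooth_section (vb_charts V) Y' ->
    smooth_section (vb_charts V) Z ->
    la_bracket (fun x => c *: Y x + Y' x) Z =
      (fun x => c *: la_bracket Y Z x + la_bracket Y' Z x);
  la_bracket_antisym : forall Y Z,
    smooth_section (vb_charts V) Y -> smooth_section (vb_charts V) Z ->
    la_bracket Y Z = (fun x => - la_bracket Z Y x);
  la_bracket_jacobi : forall Y Z W,
    smooth_section (vb_charts V) Y -> smooth_section (vb_charts V) Z ->
    smooth_section (vb_charts V) W ->
    forall x, la_bracket Y (la_bracket Z W) x +
              la_bracket Z (la_bracket W Y) x +
              la_bracket W (la_bracket Y Z) x = 0;
  la_D_smooth : forall X Z,
    smooth_section (ab_charts A) X -> smooth_section (vb_charts V) Z ->
    smooth_section (vb_charts V) (la_D X Z);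
  la_D_linear : forall X (c : R) Z Z',
    smooth_section (ab_charts A) X -> smooth_section (vb_charts V) Z ->
    smooth_section (vb_charts V) Z' ->
    la_D X (fun x => c *: Z x + Z' x) =
      (fun x => c *: la_D X Z x + la_D X Z' x);
  la_anchor_smooth : smooth (ab_charts A) (tangent_charts M) (tot la_anchor);
  la_anchor_affine : forall x, exists rhoV : V x -> tangent x,
    (forall (c : R) v w f, rhoV (c *: v + w) f = c * rhoV v f + rhoV w f) /\
    (forall (a : A x) v f, la_anchor (as_add a v) f = la_anchor a f + rhoV v f);
  la_D_bracket : forall X Y Z,
    smooth_section (ab_charts A) X -> smooth_section (vb_charts V) Y ->
    smooth_section (vb_charts V) Z ->
    la_D X (la_bracket Y Z) =
      (fun x => la_bracket (la_D X Y) Z x + la_bracket Y (la_D X Z) x);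
  la_D_add : forall X Y Z,
    smooth_section (ab_charts A) X -> smooth_section (vb_charts V) Y ->
    smooth_section (vb_charts V) Z ->
    la_D (fun x => as_add (X x) (Y x)) Z =
      (fun x => la_D X Z x + la_bracket Y Z x);
  la_D_leibniz : forall X (f : M -> R) Y,
    smooth_section (ab_charts A) X -> smooth_fun f ->
    smooth_section (vb_charts V) Y ->
    la_D X (fun x => f x *: Y x) =
      (fun x => f x *: la_D X Y x + la_anchor (X x) f *: Y x) }.

(* A section of mu is a map over the identity of M, hence the fibrewise
   presentation. *)
Definition hamiltonian_section (R : realType) (m : nat) (M : manifold R m)
    (k : nat) (V : vector_bundle M k) (A : affine_bundle V)
    (h : forall x, dual V x -> aplus A x) : Prop :=
  smooth (dual_charts V) (aplus_charts A) (tot h) /\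
  forall x (al : dual V x), mu (h x al) = al.

Definition H_of (R : realType) (m : nat) (M : manifold R m) (k : nat)
    (V : vector_bundle M k) (A : affine_bundle V)
    (h : forall x, dual V x -> aplus A x) (r : forall x, A x)
    (x : M) (al : dual V x) : R :=
  h x al (r x).

(* The vector of V x representing the differential of H_of h r along the
   fibre, under the identification of V x with its bidual. *)
Definition Fh_rel (R : realType) (m : nat) (M : manifold R m) (k : nat)
    (V : vector_bundle M k) (A : affine_bundle V)
    (h : forall x, dual V x -> aplus A x) (r : forall x, A x)
    (x : M) (al : dual V x) : V x :=
  xget 0 [set w | forall be : dual V x,
    be w = derive1 (fun t : R => (H_of h r (al + t *: be) : R^o)) 0].

Definition Fh (R : realType) (m : nat) (M : manifold R m) (k : nat)
    (V : vector_bundle M k) (A : affine_bundle V)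
    (h : forall x, dual V x -> aplus A x) (r : forall x, A x)
    (x : M) (al : dual V x) : A x :=
  as_add (r x) (- Fh_rel h r al).

(* Fh h r does not depend on the section r, and affine bundles have global
   sections. *)
Definition hyperregular_hamiltonian (R : realType) (m : nat)
    (M : manifold R m) (k : nat) (V : vector_bundle M k)
    (A : affine_bundle V) (h : forall x, dual V x -> aplus A x) : Prop :=
  exists r : forall x, A x, smooth_section (ab_charts A) r /\
    diffeomorphism (dual_charts V) (ab_charts A) (tot (Fh h r)).

Definition lagrangian (R : realType) (m : nat) (M : manifold R m) (k : nat)
    (V : vector_bundle M k) (A : affine_bundle V)
    (L : {x : M & A x} -> R) : Prop :=
  smooth (ab_charts A) (real_charts R) L.

(* [linfun f] is f itself as soon as f is linear, which is the case here when
   L is smooth; Leg_val below is then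
   L(a) + d/dt L(a + t (b - a)) at t = 0. *)
Definition fibre_differential (R : realType) (m : nat) (M : manifold R m)
    (k : nat) (V : vector_bundle M k) (A : affine_bundle V)
    (L : {x : M & A x} -> R) (x : M) (a : A x) : dual V x :=
  linfun (fun v : V x => derive1
    (fun t : R => (L (existT (fun x => A x : Type) x (as_add a (t *: v))) : R^o)) 0).

Lemma as_subD (R : realType) (V : vectType R) (A : affine_space V)
  (a b : A) (v : V) : as_sub (as_add b v) a = as_sub b a + v.
Proof. by rewrite -{1}(as_subK a b) as_addA as_addK. Qed.

Definition Leg_val (R : realType) (m : nat) (M : manifold R m) (k : nat)
    (V : vector_bundle M k) (A : affine_bundle V)
    (L : {x : M & A x} -> R) (x : M) (a b : A x) : R :=
  L (existT (fun x => A x : Type) x a) + fibre_differential L a (as_sub b a).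

Lemma Leg_affine (R : realType) (m : nat) (M : manifold R m) (k : nat)
    (V : vector_bundle M k) (A : affine_bundle V)
    (L : {x : M & A x} -> R) (x : M) (a b : A x) (v : V x) :
  Leg_val L a (as_add b v) = Leg_val L a b + fibre_differential L a v.
Proof. by rewrite /Leg_val as_subD linearD addrA. Qed.

Definition Leg (R : realType) (m : nat) (M : manifold R m) (k : nat)
    (V : vector_bundle M k) (A : affine_bundle V)
    (L : {x : M & A x} -> R) (x : M) (a : A x) : aplus A x :=
  AffineFun (Leg_affine L a).

Definition leg (R : realType) (m : nat) (M : manifold R m) (k : nat)
    (V : vector_bundle M k) (A : affine_bundle V)
    (L : {x : M & A x} -> R) (x : M) (a : A x) : dual V x :=
  mu (Leg L a).

Definition hyperregular_lagrangian (R : realType) (m : nat)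
    (M : manifold R m) (k : nat) (V : vector_bundle M k)
    (A : affine_bundle V) (L : {x : M & A x} -> R) : Prop :=
  lagrangian L /\
  diffeomorphism (ab_charts A) (dual_charts V) (tot (@leg _ _ _ _ _ _ L)).

Definition leg_inv (R : realType) (m : nat) (M : manifold R m) (k : nat)
    (V : vector_bundle M k) (A : affine_bundle V) (L : {x : M & A x} -> R)
    (hL : hyperregular_lagrangian L) : {x : M & dual V x} -> {x : M & A x} :=
  projT1 (cid (proj2 hL)).

Definition ham_of (R : realType) (m : nat) (M : manifold R m) (k : nat)
    (V : vector_bundle M k) (A : affine_bundle V) (L : {x : M & A x} -> R)
    (hL : hyperregular_lagrangian L) :
    {x : M & dual V x} -> {x : M & aplus A x} :=
  tot (@Leg _ _ _ _ _ _ L) \o leg_inv hL.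

(* Main.v *)
Require Import Defs.
From HB Require Import structures.
From mathcomp Require Import all_boot all_order all_algebra.
From mathcomp Require Import all_classical all_reals all_analysis.
Set Implicit Arguments.
Unset Strict Implicit.
Unset Printing Implicit Defensive.
Import Order.TTheory GRing.Theory Num.Theory.
Import numFieldNormedType.Exports.
Local Open Scope classical_set_scope.
Local Open Scope ring_scope.

(** The Lagrangian is the Legendre transform of the Hamiltonian section.  Let g
    be the inverse of Fh; it preserves base points, so it is given by maps
    g x : A x -> dual V x.  Put

      L a = h (g a) a,

    the value at a of the affine function h (g a).

    The heart of the matter is that the differential of L along the fibres is g
    (fibre_differential_legendre).  Fix a section r and write H al = h al (r x).
    Since h al is affine with linear part al, L a = H (g a) + g a (a - r), so
    the derivative of L at a in the direction v is

      dH (dg v) + dg v (a - r) + g a v.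

    By construction of Fh the differential of H at g a is evaluation at a vector
    w, and a = Fh (g a) = r - w; the first two terms cancel, and g a v is left.

    Therefore Leg L a, the affine function with linear part g a and value
    L a = h (g a) a at a, is h (g a) itself (Leg_legendre).  In particular
    leg L = g is a diffeomorphism, and Leg L composed with the inverse of leg L
    is h.

    Smoothness is checked in charts, where the chain rule for iterated
    directional derivatives (Ck_comp) gives the smoothness of compositions.
    Composing g and h also requires the transition maps between charts of the
    dual bundle to be smooth (dual_atlas); their coefficients are read off the
    transition maps of V.  Then L is the pairing of coordinates
    p_0 + sum_l p_l y^l of h o g and of the identity of A, read in matching
    charts (legendre_transform_smooth). *)

(** * Functions of class Ck on open sets *)

Lemma Ck_sub (R : realType) (E F : normedModType R) k (U W : set E)
  (f : E -> F) : U `<=` W -> Ck k W f -> Ck k U f.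
Proof.
elim: k f => [|k IH] f sUW /=; first by move=> Wf u /sUW; exact: Wf.
by move=> [Wd WD]; split=> [u /sUW|v]; [exact: Wd|exact: IH].
Qed.

Lemma Cinf_sub (R : realType) (E F : normedModType R) (U W : set E)
  (f : E -> F) : U `<=` W -> Cinf W f -> Cinf U f.
Proof. by move=> sUW Wf k; exact: Ck_sub (Wf k). Qed.

Lemma Ck_continuous (R : realType) (E F : normedModType R) k (U : set E)
  (f : E -> F) u : Ck k U f -> U u -> {for u, continuous f}.
Proof.
case: k => [|k] /=; first by move=> Uf /Uf.
by move=> [Ud _] /Ud; exact: differentiable_continuous.
Qed.

Lemma CkW (R : realType) (E F : normedModType R) k (U : set E)
  (f : E -> F) : Ck k.+1 U f -> Ck k U f.
Proof.
elim: k f => [|k IH] f; first by move=> Uf u; exact: (Ck_continuous Uf).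
by move=> [Ud UD]; split=> // v; exact/IH/UD.
Qed.

(** The differential of f is a linear map with the expansion required of a
    differential of g, and such a map is unique. *)
Lemma near_eq_differentiable (R : realType) (E F : normedModType R)
  (f g : E -> F) (u : E) : (\forall y \near u, f y = g y) ->
  differentiable f u -> differentiable g u.
Proof.
move=> fg df; have [cf ef] := (diff_locallyP u f).1 df.
have eg : g \o shift u = cst (g u) + 'd f u +o_ 0 id.
  apply/eqaddoP => e e0; move/eqaddoP : ef => /(_ e e0).
  apply: filterS2 => [y|]; last first.
    move: fg; rewrite (near_shift 0 u); apply.
  rewrite /= !fctE /= subr0 => <-.
  by rewrite (nbhs_singleton fg).
apply/diff_locallyP.
by have -> : 'd g u = 'd f u :> (E -> F) by exact: diff_unique.
Qed.

(** The Leibniz rule for scalar times vector, from the differential of the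
    continuous bilinear map (a, w) |-> a *: w. *)
Lemma differentiable_scale (R : realType) (E F : normedModType R)
  (f : E -> R^o) (g : E -> F) u v :
  differentiable f u -> differentiable g u ->
  differentiable (fun x => f x *: g x) u /\
  'D_v (fun x => f x *: g x) u = 'D_v f u *: g u + f u *: 'D_v g u.
Proof.
move=> df dg.
pose b (a : R^o) (w : F) := a *: w.
have bl : bilinear_for
    (GRing.Scale.Law.clone _ _ *:%R _) (GRing.Scale.Law.clone _ _ *:%R _) b.
  rewrite /b.
  split=> [w|a] c x y /=; first by rewrite scalerDl scalerA.
  by rewrite scalerDr !scalerA mulrC.
pose bM := bilinear_isBilinear.Build R R^o F F _ _ b bl.
pose B : {bilinear R^o -> F -> F} := HB.pack b bM.
have cB : continuous (fun p : R^o * F => B p.1 p.2).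
  move=> p; exact: scale_continuous.
have dB p := differentiable_bilin p cB.
have dfg := differentiable_pair df dg.
have d : differentiable (fun x => f x *: g x) u.
  exact: (differentiable_comp dfg (dB _)).
split=> //.
rewrite deriveE // (_ : (fun x => f x *: g x) =
  (fun p : R^o * F => B p.1 p.2) \o (fun x => (f x, g x))) //.
by rewrite diff_comp // diff_bilin //= diff_pair //= !deriveE // addrC.
Qed.

Lemma eq_Ck (R : realType) (E F : normedModType R) k (U : set E)
  (f g : E -> F) : open U -> (forall u, U u -> f u = g u) ->
  Ck k U f -> Ck k U g.
Proof.
move=> oU; elim: k f g => [|k IH] f g fg /=.
  move=> Uf u Uu; have fgu : \forall y \near u, f y = g y.
    by apply: filterS (open_nbhs_nbhs (conj oU Uu)).
  have : g @ u --> f u by apply: cvg_trans (Uf u Uu); exact: near_eq_cvg.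
  by rewrite fg.
have near_fg u : U u -> \forall y \near u, f y = g y.
  by move=> Uu; apply: filterS (open_nbhs_nbhs (conj oU Uu)).
move=> [Uf UD]; split=> [u Uu|v].
  by apply: near_eq_differentiable (near_fg _ Uu) _; exact: Uf.
apply: IH (UD v) => u Uu; exact/near_eq_derive/near_fg.
Qed.

Lemma Ck_cst (R : realType) (E F : normedModType R) k (U : set E) (a : F) :
  Ck k U (fun=> a).
Proof.
elim: k a => [|k IH] a /=; first by move=> u _; exact: cvg_cst.
split=> [u _|v]; first exact: differentiable_cst.
rewrite (_ : (fun u : E => 'D_v _ u) = fun=> 0); first exact: IH.
by apply/funext => u; rewrite derive_cst.
Qed.

Lemma Ck_add (R : realType) (E F : normedModType R) k (U : set E)
  (f g : E -> F) : open U -> Ck k U f -> Ck k U g ->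
  Ck k U (fun u => f u + g u).
Proof.
move=> oU; elim: k f g => [|k IH] f g /=.
  move=> Uf Ug u Uu; apply: cvgD; [exact: Uf|exact: Ug].
move=> [df Df] [dg Dg]; split=> [u Uu|v].
  by apply: differentiableD; [exact: df|exact: dg].
apply: eq_Ck (IH _ _ (Df v) (Dg v)) => // u Uu /=.
by rewrite deriveD //; apply: diff_derivable; [exact: df|exact: dg].
Qed.

Lemma Ck_sum (R : realType) (E F : normedModType R) k (U : set E) (I : Type)
  (r : seq I) (f : I -> E -> F) : open U -> (forall i, Ck k U (f i)) ->
  Ck k U (fun u => \sum_(i <- r) f i u).
Proof.
move=> oU Uf; elim: r => [|i r IH].
  by apply: eq_Ck (Ck_cst _ _ 0) => // u _; rewrite big_nil.
by apply: eq_Ck (Ck_add oU (Uf i) IH) => // u _; rewrite big_cons.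
Qed.

(** The derivative of f *: g involves f and g undifferentiated, hence the use
    of CkW in the induction. *)
Lemma Ck_scale (R : realType) (E F : normedModType R) k (U : set E)
  (f : E -> R^o) (g : E -> F) : open U -> Ck k U f -> Ck k U g ->
  Ck k U (fun u => f u *: g u).
Proof.
move=> oU; elim: k f g => [|k IH] f g.
  by move=> Uf Ug u Uu; apply: cvgZ; [exact: Uf|exact: Ug].
move=> Uf Ug; have [df Df] := Uf; have [dg Dg] := Ug.
split=> [u Uu|v].
  exact: (proj1 (differentiable_scale 0 (df _ Uu) (dg _ Uu))).
have D := Ck_add oU (IH _ _ (Df v) (CkW Ug)) (IH _ _ (CkW Uf) (Dg v)).
apply: (eq_Ck _ _ D) => // u Uu.
by rewrite (proj2 (differentiable_scale v (df _ Uu) (dg _ Uu))).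
Qed.

Lemma Ck_linear (R : realType) (E F G : normedModType R) k (U : set E)
  (l : F -> G) (f : E -> F) : open U -> linear l -> continuous l ->
  Ck k U f -> Ck k U (l \o f).
Proof.
move=> oU lin_l cl.
pose lM := GRing.isLinear.Build R F G _ l lin_l.
pose L : {linear F -> G} := HB.pack l lM.
elim: k f => [|k IH] f.
  by move=> Uf u Uu; apply: continuous_comp; [exact: Uf|exact: cl].
move=> [df Df].
have dL w : differentiable (L : F -> G) w by exact: linear_differentiable.
split=> [u Uu|v].
  by apply: differentiable_comp; [exact: df|exact: dL].
apply: (eq_Ck _ _ (IH _ (Df v))) => // u Uu.
have dfu := df _ Uu.
have dLf : differentiable (L \o f) u by apply: differentiable_comp.
rewrite -[RHS]/('D_v (L \o f) u) (deriveE _ dLf) (diff_comp dfu (dL _)).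
by rewrite [RHS]/= (@diff_lin _ _ _ L) // -(deriveE _ dfu).
Qed.

(** Finite-dimensionality, in the form that the chain rule uses: every vector is
    the combination of finitely many fixed vectors, with continuous linear
    coefficients. *)
Definition has_coordinates (R : realType) (F : normedModType R) : Prop :=
  exists n (e : 'I_n -> F) (c : 'I_n -> F -> R^o),
    (forall i, linear (c i) /\ continuous (c i)) /\
    forall v, v = \sum_i c i v *: e i.

(** By the chain rule the derivative of g \o f at u along v is the derivative of
    g at f u along 'D_v f u.  This direction varies with u, whereas the
    induction hypothesis speaks of derivatives of g along fixed directions:
    expanding 'D_v f u on a basis e reduces to the functions 'D_(e i) g \o f. *)
Lemma Ck_comp (R : realType) (E F G : normedModType R) k (U : set E)
  (W : set F) (f : E -> F) (g : F -> G) : has_coordinates F -> open U ->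
  (forall u, U u -> W (f u)) -> Ck k U f -> Ck k W g -> Ck k U (g \o f).
Proof.
move=> [n [e [c [cP eP]]]] oU; elim: k g => [|k IH] g UW.
  move=> Uf Wg u Uu; apply: continuous_comp; first exact: Uf.
  exact: (Wg _ (UW _ Uu)).
move=> Uf Wg; have [df Df] := Uf; have [dg Dg] := Wg.
have dgf u : U u -> differentiable (g \o f) u.
  move=> Uu; apply: differentiable_comp; first exact: df.
  exact: (dg _ (UW _ Uu)).
split=> // v.
have H : Ck k U (fun u => \sum_i c i ('D_v f u) *: 'D_(e i) g (f u)).
  apply: Ck_sum => // i; apply: Ck_scale => //.
    have [li ci] := cP i; exact: (Ck_linear oU li ci (Df v)).
  exact: (IH (fun w => 'D_(e i) g w) UW (CkW Uf) (Dg (e i))).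
apply: (eq_Ck _ _ H) => // u Uu.
have dfu := df u Uu; have dgfu := dg _ (UW _ Uu).
rewrite [RHS]deriveE; last exact: dgf.
rewrite diff_comp // [RHS]/= -(deriveE _ dfu) [in RHS](eP ('D_v f u)).
rewrite linear_sum.
by apply: eq_bigr => i _; rewrite linearZ /= (deriveE _ dgfu).
Qed.

Lemma Ck_pair (R : realType) (E F G : normedModType R) k (U : set E)
  (f : E -> F) (g : E -> G) : open U -> Ck k U f -> Ck k U g ->
  Ck k U (fun u => (f u, g u)).
Proof.
move=> oU Uf Ug.
have l1 : linear (fun w : F => (w, 0 : G)).
  by move=> a x y; congr pair; rewrite /= scaler0 addr0.
have l2 : linear (fun w : G => (0 : F, w)).
  by move=> a x y; congr pair; rewrite /= scaler0 addr0.
have c1 : continuous (fun w : F => (w, 0 : G)).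
  by move=> x; apply: cvg_pair; [exact: cvg_id|exact: cvg_cst].
have c2 : continuous (fun w : G => (0 : F, w)).
  by move=> x; apply: cvg_pair; [exact: cvg_cst|exact: cvg_id].
have S := Ck_add oU (Ck_linear oU l1 c1 Uf) (Ck_linear oU l2 c2 Ug).
apply: (eq_Ck _ _ S) => // u _ /=.
by congr pair; rewrite /= ?addr0 ?add0r.
Qed.

Lemma Ck_row (R : realType) (E : normedModType R) k n (U : set E)
  (f : 'I_n -> E -> R^o) : open U -> (forall i, Ck k U (f i)) ->
  Ck k U (fun u => \row_i f i u).
Proof.
move=> oU Uf.
have H : Ck k U (fun u => \sum_i f i u *: (delta_mx 0 i : 'rV[R]_n)).
  by apply: Ck_sum => // i; apply: Ck_scale => //; exact: Ck_cst.
apply: (eq_Ck _ _ H) => // u _.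
by rewrite [RHS]row_sum_delta; apply: eq_bigr => i _; rewrite mxE.
Qed.

Lemma Ck_fst (R : realType) (E F G : normedModType R) k (U : set E)
  (f : E -> F * G) : open U -> Ck k U f -> Ck k U (fun u => (f u).1).
Proof.
move=> oU; apply: (Ck_linear (l := fst)) => //.
by move=> x; exact: cvg_fst.
Qed.

Lemma Ck_snd (R : realType) (E F G : normedModType R) k (U : set E)
  (f : E -> F * G) : open U -> Ck k U f -> Ck k U (fun u => (f u).2).
Proof.
move=> oU; apply: (Ck_linear (l := snd)) => //.
by move=> x; exact: cvg_snd.
Qed.

Lemma linear_coord (R : realType) n (i : 'I_n) :
  linear (fun v : 'rV[R]_n => v 0 i : R^o).
Proof. by move=> a x y; rewrite !mxE. Qed.

Lemma Ck_coord (R : realType) (E : normedModType R) k n (U : set E)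
  (f : E -> 'rV[R]_n) i : open U -> Ck k U f -> Ck k U (fun u => f u 0 i : R^o).
Proof.
move=> oU; apply: (Ck_linear (l := fun v : 'rV[R]_n => v 0 i : R^o)) => //.
  exact: linear_coord.
exact: coord_continuous.
Qed.

Lemma Ck_id (R : realType) (E : normedModType R) k (U : set E) :
  Ck k U id.
Proof.
case: k => [|k]; first by move=> u _; exact: cvg_id.
split=> [u _|v]; first by [].
rewrite (_ : (fun u : E => 'D_v _ u) = fun=> v); first exact: Ck_cst.
by apply/funext => u; rewrite derive_id.
Qed.

Lemma row_has_coordinates (R : realType) n : has_coordinates 'rV[R]_n.
Proof.
exists n, (fun i => delta_mx 0 i), (fun i (v : 'rV[R]_n) => v 0 i : R^o).
split=> [i|v].
  by split; [exact: linear_coord|exact: coord_continuous].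
exact: row_sum_delta.
Qed.

Lemma pair_has_coordinates (R : realType) (F G : normedModType R) :
  has_coordinates F -> has_coordinates G -> has_coordinates (F * G)%type.
Proof.
move=> [n [e [c [cP eP]]]] [n' [e' [c' [cP' eP']]]].
exists (n + n')%N, (fun i => match fintype.split i with
  inl j => (e j, 0) | inr j => (0, e' j) end),
  (fun i v => match fintype.split i with
  inl j => c j v.1 | inr j => c' j v.2 end).
split=> [i|v].
  case: fintype.split => j;
    [have [l cj] := cP j|have [l cj] := cP' j]; split=> //.
  - by move=> a x y; exact: l.
  - by move=> x; apply: continuous_comp; [exact: cvg_fst|exact: cj].
  - by move=> a x y; exact: l.
  - by move=> x; apply: continuous_comp; [exact: cvg_snd|exact: cj].
rewrite big_split_ord /=.
under eq_bigr do rewrite (unsplitK (inl _)).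
under [X in _ + X]eq_bigr do rewrite (unsplitK (inr _)).
case: v => v w; apply: injective_projections => /=.
  rewrite (raddf_sum fst) (raddf_sum fst) /= [X in _ + X]big1 ?addr0 //.
    by move=> j _; rewrite scaler0.
rewrite (raddf_sum snd) (raddf_sum snd) /= [X in X + _]big1 ?add0r //.
by move=> j _; rewrite scaler0.
Qed.

Lemma row_pair_has_coordinates (R : realType) m n :
  has_coordinates ('rV[R]_m * 'rV[R]_n)%type.
Proof. by apply: pair_has_coordinates; exact: row_has_coordinates. Qed.

Lemma open_setI_preimage (R : realType) (E F : normedModType R) (U : set E)
  (W : set F) (f : E -> F) : open U -> open W ->
  (forall u, U u -> {for u, continuous f}) -> open (U `&` f @^-1` W).
Proof.
move=> oU oW cf; rewrite openE => u [Uu Wfu]; apply: filterI.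
  exact: open_nbhs_nbhs (conj oU Uu).
by apply: (cf u Uu); exact: open_nbhs_nbhs (conj oW Wfu).
Qed.

Lemma Cinf_continuous (R : realType) (E F : normedModType R) (U : set E)
  (f : E -> F) : Cinf U f -> forall u, U u -> {for u, continuous f}.
Proof. by move=> Uf; exact: (Uf 0%N). Qed.

Lemma Cinf_comp (R : realType) (E F G : normedModType R) (U : set E)
  (W : set F) (f : E -> F) (g : F -> G) : has_coordinates F -> open U ->
  (forall u, U u -> W (f u)) -> Cinf U f -> Cinf W g -> Cinf U (g \o f).
Proof. by move=> cF oU UW Uf Wg k; exact: Ck_comp UW (Uf k) (Wg k). Qed.

Lemma Cinf_preimage (R : realType) (E F G : normedModType R) (f : E -> F)
  (g : F -> G) (W : set F) : has_coordinates F -> Cinf setT f -> open W ->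
  Cinf W g -> open (f @^-1` W) /\ Cinf (f @^-1` W) (g \o f).
Proof.
move=> cF sf oW sg; have oU : open (f @^-1` W).
  rewrite -[_ @^-1` _]setTI; apply: open_setI_preimage => //.
    exact: openT.
  exact: Cinf_continuous.
by split=> //; apply: (Cinf_comp cF oU _ _ sg) => //; exact: Cinf_sub sf.
Qed.

(** * Smooth maps in charts *)

Definition overlap (R : realType) (X : Type) (E : normedModType R)
  (C : charts X E) (i j : ch_idx C) : set E :=
  ch_map i @` (ch_dom i `&` ch_dom j).

Lemma overlap_dom (R : realType) (X : Type) (E : normedModType R)
  (C : charts X E) (i j : ch_idx C) x : is_atlas C -> ch_dom i x ->
  overlap i j (ch_map i x) -> ch_dom j x.
Proof.
move=> [_ inj _ _] ix [y [iy jy] yx].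
by have <- : y = x by apply: (inj i) => //; exact/mem_set.
Qed.

(** The conditions under the quantifiers of [smooth_at], kept apart so that the
    charts can be chosen. *)
Definition expressed_by (R : realType) (X Y : Type) (E F : normedModType R)
    (C : charts X E) (C' : charts Y F) (i : ch_idx C) (j : ch_idx C')
    (f : X -> Y) (x : X) (O : set E) (phi : E -> F) : Prop :=
  [/\ ch_dom i x, open O /\ O (ch_map i x), O `<=` ch_map i @` ch_dom i,
      Cinf O phi & forall y, ch_dom i y -> O (ch_map i y) ->
          ch_dom j (f y) /\ ch_map j (f y) = phi (ch_map i y)].

Lemma expressed_by_comp (R : realType) (X Y Z : Type) (E F G : normedModType R)
    (C : charts X E) (C' : charts Y F) (C'' : charts Z G)
    (i : ch_idx C) (j : ch_idx C') (l : ch_idx C'')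
    (f : X -> Y) (g : Y -> Z) (x : X) O O' phi psi : has_coordinates F ->
  expressed_by i j f x O phi -> expressed_by j l g (f x) O' psi ->
  expressed_by i l (g \o f) x (O `&` phi @^-1` O') (psi \o phi).
Proof.
move=> cF [ix [oO Ox] sO sm_phi phiE] [jx [oO' O'x] sO' sm_psi psiE].
have oU : open (O `&` phi @^-1` O').
  by apply: open_setI_preimage => //; exact: Cinf_continuous.
split=> //.
- by split=> //; split=> //=; have [_ <-] := phiE _ ix Ox.
- by move=> u [Ou _]; exact: sO.
- apply: (Cinf_comp cF oU _ _ sm_psi); first by move=> u [].
  by apply: Cinf_sub sm_phi => u [].
- move=> y iy [Oy /= O'y]; have [jy ey] := phiE _ iy Oy.
  have [|ly ey'] := psiE _ jy; first by rewrite ey.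
  by split=> //=; rewrite ey' ey.
Qed.

Lemma expressed_by_transition (R : realType) (X : Type) (E : normedModType R)
    (C : charts X E) (i j : ch_idx C) (x : X) : is_atlas C ->
  ch_dom i x -> ch_dom j x ->
  exists O T, expressed_by i j id x O T.
Proof.
move=> atl ix jx; have [_ inj opn tr] := atl.
have [T [smT TE]] := tr i j.
exists (overlap i j), T; split=> //.
- by split; [exact: opn|exists x].
- by move=> _ [y [iy _] <-]; exists y.
- move=> y iy /(overlap_dom atl iy) jy; split=> //; exact/esym/TE.
Qed.

(** Smoothness at a point can be tested in any pair of charts around the point
    and its image, by composing with transition maps on both sides. *)
Lemma smooth_at_in_charts (R : realType) (X Y : Type) (E F : normedModType R)
    (C : charts X E) (C' : charts Y F) (f : X -> Y) (x : X)
    (i : ch_idx C) (j : ch_idx C') :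
  has_coordinates E -> has_coordinates F -> is_atlas C -> is_atlas C' ->
  smooth_at C C' f x -> ch_dom i x -> ch_dom j (f x) ->
  exists O phi, expressed_by i j f x O phi.
Proof.
move=> cE cF atl atl' [i0 [j0 [U0 [phi fE]]]] ix jx.
have [i0x [_ U0x] _ _ phiE] := fE; have [j0x _] := phiE _ i0x U0x.
have [U [T TE]] := expressed_by_transition atl ix i0x.
have [W [S SE]] := expressed_by_transition atl' j0x jx.
have H := expressed_by_comp cF (expressed_by_comp cE TE fE) SE.
by do 2!eexists; exact: H.
Qed.

Lemma smooth_at_comp (R : realType) (X Y Z : Type) (E F G : normedModType R)
    (C : charts X E) (C' : charts Y F) (C'' : charts Z G)
    (f : X -> Y) (g : Y -> Z) (x : X) : has_coordinates E ->
  has_coordinates F -> is_atlas C -> is_atlas C' ->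
  smooth_at C C' f x -> smooth_at C' C'' g (f x) -> smooth_at C C'' (g \o f) x.
Proof.
move=> cE cF atl atl' fx [j [l [W [psi gE]]]].
have [[i [_ [_ [_ [ix _ _ _ _]]]]] [jx _ _ _ _]] := (fx, gE).
have [U0 [phi fE]] := smooth_at_in_charts cE cF atl atl' fx ix jx.
exists i, l; do 2!eexists; exact: expressed_by_comp fE gE.
Qed.

(** * Charts of the dual bundle *)

Definition dual_coord (R : realType) (k : nat) (V : vectType R)
  (e : k.-tuple V) (b : 'Hom(V, R^o)) : 'rV[R]_k := \row_l b (tnth e l).

Definition of_coord (R : realType) (k : nat) (V : vectType R)
  (e : k.-tuple V) (y : 'rV[R]_k) : V := \sum_l y 0 l *: tnth e l.

Definition of_dual_coord (R : realType) (k : nat) (V : vectType R)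
  (e : k.-tuple V) (p : 'rV[R]_k) : 'Hom(V, R^o) :=
  linfun (fun v : V => \sum_l coord e l v * p 0 l : R^o).

Section Frame.
Variables (R : realType) (k : nat) (V : vectType R) (e : k.-tuple V).
Hypothesis eB : basis_of fullv e.

Lemma frame_coordK : cancel (frame_coord e) (of_coord e).
Proof.
move=> v; rewrite /of_coord [RHS](coord_basis eB (memvf v)).
by apply: eq_bigr => l _; rewrite mxE (tnth_nth 0).
Qed.

Lemma coord_frame i l : coord e l (tnth e i) = (i == l)%:R.
Proof. by rewrite (tnth_nth 0) coord_free ?(basis_free eB) 1?eq_sym. Qed.

Lemma of_coordK : cancel (of_coord e) (frame_coord e).
Proof.
move=> y; apply/rowP => l; rewrite mxE /of_coord linear_sum (bigD1 l) //=.
rewrite big1 ?addr0 => [|i il]; rewrite linearZ /= coord_frame ?eqxx ?mulr1 //.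
by rewrite (negbTE il) mulr0.
Qed.

Lemma dual_pairing (b : 'Hom(V, R^o)) v :
  b v = \sum_l frame_coord e v 0 l * dual_coord e b 0 l.
Proof.
rewrite -{1}(frame_coordK v) linear_sum; apply: eq_bigr => l _.
by rewrite linearZ !mxE.
Qed.

Lemma of_dual_coordE p v :
  of_dual_coord e p v = \sum_l frame_coord e v 0 l * p 0 l.
Proof.
pose f (u : V) : R^o := \sum_l coord e l u * p 0 l.
have lf : linear f.
  rewrite /f => a u w; rewrite scaler_sumr -big_split /=; apply: eq_bigr => l _.
  by rewrite linearP /= mulrDl scalerAl.
pose fM := GRing.isLinear.Build R V R^o _ _ lf.
pose L : {linear V -> R^o} := HB.pack f fM.
rewrite -[of_dual_coord e p]/(linfun L) lfunE /= /f.
by apply: eq_bigr => l _; rewrite mxE.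
Qed.

Lemma of_dual_coordK : cancel (of_dual_coord e) (dual_coord e).
Proof.
move=> p; apply/rowP => l; rewrite mxE of_dual_coordE (bigD1 l) //=.
rewrite mxE coord_frame eqxx mul1r big1 ?addr0 // => i il.
by rewrite mxE coord_frame eq_sym (negbTE il) mul0r.
Qed.

Lemma dual_coord_inj : injective (dual_coord e).
Proof. by move=> b c bc; apply/lfunP => v; rewrite !dual_pairing bc. Qed.

Lemma dual_coordK : cancel (dual_coord e) (of_dual_coord e).
Proof. by move=> b; apply: dual_coord_inj; rewrite of_dual_coordK. Qed.

End Frame.

(** Both sides consist of the pairs (xi, p) with xi in the image of the overlap
    of the base domains and p arbitrary: all coordinates occur, in V as in its
    dual. *)
Lemma dual_overlap (R : realType) (m k : nat) (M : manifold R m)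
  (V : vector_bundle M k) (i j : ch_idx (vb_charts V)) :
  overlap (C := dual_charts V) i j = overlap (C := vb_charts V) i j.
Proof.
apply/seteqP; split=> _ [[x v] [/= [i1x i2x] jx] <-] /=;
  have eB := vb_basis i2x; set e := vb_frame i.2 x.
  exists (existT (fun x => V x : Type) x (of_coord e (dual_coord e v))) => //=.
  by rewrite of_coordK.
exists (existT (fun x => dual V x : Type) x
  (of_dual_coord e (frame_coord e v))) => //=.
by rewrite -/(dual_coord _ _) of_dual_coordK.
Qed.

(** Let e and e' be the frames of the two charts.  The dual coordinates of a
    functional b transform by b (e' l) = sum_n e^n (e' l) * b (e n).  The
    coefficients e^n (e' l) are components of the transition map of V from the
    frame e' to the frame e over the same base chart, at the point with
    coordinates delta_l, which represents e' l: hence they are smooth. *)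
Lemma dual_atlas (R : realType) (m k : nat) (M : manifold R m)
  (V : vector_bundle M k) : is_atlas (dual_charts V).
Proof.
have [_ _ opV trV] := vb_atlas V; have [cM injM opM trM] := mf_atlas M.
have opD (i j : ch_idx (dual_charts V)) : open (overlap i j).
  by rewrite dual_overlap; exact: opV.
have cE := row_pair_has_coordinates R m k.
split.
- move=> [x b]; have [i ix] := cM x; have [j jx] := vb_cover V x.
  by exists (i, j).
- move=> [i j] [x b] [y c] /set_mem[/= ix jx] /set_mem[/= iy jy] [xy].
  have {xy} xy : x = y by apply: (injM i) => //; exact/mem_set.
  by case: _ / xy c iy jy => c _ _ /(dual_coord_inj (vb_basis jx)) ->.
- exact: opD.
move=> [i1 j1] [i2 j2].
have [T [smT TE]] := trM i1 i2.
(* N goes from the frame j2 to the frame j1, both over the base chart i1, so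
   that the coefficients are functions of the coordinates of i1. *)
have [N [smN NE]] := trV (i1, j2) (i1, j1).
have deltaE x l : vb_dom j2 x ->
    delta_mx 0 l = frame_coord (vb_frame j2 x) (tnth (vb_frame j2 x) l).
  move=> j2x; apply/rowP => n.
  by rewrite !mxE coord_frame ?eqxx /= 1?eq_sym //; exact: vb_basis.
pose W := overlap (C := dual_charts V) (i1, j1) (i2, j2).
have oW : open W by exact: opD.
pose B (u : 'rV[R]_m * 'rV[R]_k) l n : R^o := (N (u.1, delta_mx 0 l)).2 0 n.
exists (fun u => (T u.1, \row_l \sum_n (B u l n *: (u.2 0 n : R^o)))); split.
  move=> q; have sm1 : Ck q W (fun u => u.1) := Ck_fst oW (Ck_id q W).
  have sm2 : Ck q W (fun u => u.2) := Ck_snd oW (Ck_id q W).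
  apply: (Ck_pair oW).
    apply: (Ck_comp (row_has_coordinates R m) oW _ sm1 (smT q)).
    by move=> _ [[x b] [[/= ix jx] [/= ix' jx']] <-]; exists x.
  apply: (Ck_row oW) => l; apply: (Ck_sum _ oW) => n.
  apply: (Ck_scale oW _ (Ck_coord n oW sm2)).
  apply: (Ck_coord n oW); apply: (Ck_snd oW).
  have sm3 := Ck_pair oW sm1 (Ck_cst q W (delta_mx 0 l : 'rV[R]_k)).
  apply: (Ck_comp cE oW _ sm3 (smN q)).
  move=> _ [[x b] [[/= ix jx] [/= ix' jx']] <-].
  exists (existT (fun x => V x : Type) x (tnth (vb_frame j2 x) l)) => //=.
  by rewrite -deltaE.
move=> [x b] [/= ix jx] [/= ix' jx'].
rewrite TE //; congr pair; apply/rowP => l; rewrite !mxE.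
rewrite (dual_pairing (vb_basis jx)); apply: eq_bigr => n _.
rewrite /B /= !mxE; congr (_ * _).
have /(_ (conj ix jx') (conj ix jx))/(congr1 snd) /= :=
  NE (existT (fun x => V x : Type) x (tnth (vb_frame j2 x) l)).
by rewrite -deltaE // => ->; rewrite mxE.
Qed.

(** * Derivatives along the fibres *)

Lemma affine_fun_coord (R : realType) (k : nat) (V : vectType R)
  (A : affine_space V) (e : k.-tuple V) (f : affine_fun A) (a o : A) :
  basis_of fullv e -> f a = f o +
    \sum_l frame_coord e (as_sub a o) 0 l * dual_coord e (af_lin f) 0 l.
Proof. by move=> eB; rewrite -dual_pairing // -af_affine as_subK. Qed.

Section Fibre.
Variables (R : realType) (m k : nat) (M : manifold R m).
Variables (V : vector_bundle M k) (A : affine_bundle V).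
Variables (h : forall x, dual V x -> aplus A x) (r : forall x, A x).

Definition ham_coord (x : M) (e : k.-tuple (V x)) (p : 'rV[R]_k) : R^o :=
  H_of h r (of_dual_coord e p).

(** A coordinate expression of h gives p_0 and the p_l of the affine function
    h al; its value at r x is p_0 + sum_l p_l y^l, where y are the coordinates
    of r x. *)
Lemma ham_coord_differentiable (i : ch_idx (mf_charts M)) (j : vb_idx V)
  (l : ch_idx (aplus_charts A)) (x : M) (al : dual V x) O psi :
  @expressed_by _ _ _ _ _ (dual_charts V) (aplus_charts A) (i, j) l (tot h)
    (existT (fun x => dual V x : Type) x al) O psi ->
  differentiable (ham_coord (vb_frame j x)) (dual_coord (vb_frame j x) al).
Proof.
move=> [[/= ix jx] [oO Ox] _ sm_psi psiE]; set e := vb_frame j x.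
have eB : basis_of fullv e := vb_basis jx.
pose inc (p : 'rV[R]_k) := (ch_map i x, p).
have sm_inc : Cinf setT inc.
  by move=> q; apply: Ck_pair; [exact: openT|exact: Ck_cst|exact: Ck_id].
have [oU sm_at] :=
  Cinf_preimage (row_pair_has_coordinates R m k) sm_inc oO sm_psi.
set U := inc @^-1` O in oU sm_at.
pose y := frame_coord (vb_frame (ab_frame l.2) x)
  (as_sub (r x) (ab_origin l.2 x)).
have sm_H : Ck 1 U (ham_coord e).
  pose G := fun p => (psi (inc p)).2.1 +
    \sum_n y 0 n *: ((psi (inc p)).2.2 0 n : R^o).
  apply: (@eq_Ck _ _ _ 1 U G) => // [p Op|].
    have := psiE (existT (fun x => dual V x : Type) x (of_dual_coord e p)).
    rewrite /= -/e -/(dual_coord e _) of_dual_coordK //.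
    move=> /(_ (conj ix jx) Op)[[_ lx] hE]; rewrite /G /inc -hE /=.
    rewrite /ham_coord /H_of.
    rewrite (affine_fun_coord _ (r x) (ab_origin l.2 x)
      (vb_basis (ab_dom_sub lx))).
    by congr (_ + _); apply: eq_bigr => n _; rewrite !mxE.
  have sm2 := Ck_snd oU (sm_at 1%N).
  apply: Ck_add => //; first exact: Ck_fst oU sm2.
  apply: Ck_sum => // n; apply: Ck_scale => //; first exact: Ck_cst.
  exact: Ck_coord oU (Ck_snd oU sm2).
by apply: (proj1 sm_H); exact: Ox.
Qed.

(** The vector [Fh_rel] is chosen with [xget]; this lemma is where such a vector
    is shown to exist, namely the one whose coordinates are the partial
    derivatives of H. *)
Lemma Fh_rel_gradient (x : M) (e : k.-tuple (V x)) (al be : dual V x) :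
  basis_of fullv e -> differentiable (ham_coord e) (dual_coord e al) ->
  be (Fh_rel h r al) = 'd (ham_coord e) (dual_coord e al) (dual_coord e be).
Proof.
move=> eB dH; set p := dual_coord e al.
have dE (b : dual V x) :
    derive1 (fun t : R => (H_of h r (al + t *: b) : R^o)) 0 =
    'd (ham_coord e) p (dual_coord e b).
  rewrite -deriveE // /derive1 /derive.
  apply: (congr1 (fun D : R -> R^o => lim (D @ 0^'))); apply/funext => t /=.
  rewrite addr0 scale0r addr0 /ham_coord /p dual_coordK //.
  congr (_ *: (H_of _ _ _ - _)).
  apply: (dual_coord_inj eB); rewrite of_dual_coordK //.
  by apply/rowP => n; rewrite !mxE add_lfunE scale_lfunE addrC.
have [w wP] : exists w : V x, forall b : dual V x,
    b w = 'd (ham_coord e) p (dual_coord e b).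
  exists (of_coord e (\row_l 'd (ham_coord e) p (delta_mx 0 l))) => b.
  rewrite (dual_pairing eB) of_coordK //.
  rewrite [in RHS](row_sum_delta (dual_coord e b)) linear_sum.
  by apply: eq_bigr => l _; rewrite linearZ /= !mxE mulrC.
rewrite /Fh_rel; case: xgetP => [_ -> /(_ be) ->|/(_ w)]; first exact: dE.
by case=> b; rewrite wP dE.
Qed.

Variable g : forall x, A x -> dual V x.

(** In a chart of A the path t |-> a + t v is affine in t. *)
Lemma path_coord_differentiable (i : ch_idx (ab_charts A))
  (l : ch_idx (dual_charts V)) (x : M) (a : A x) (v : V x) O phi :
  @expressed_by _ _ _ _ _ (ab_charts A) (dual_charts V) i l (tot g)
    (existT (fun x => A x : Type) x a) O phi ->
  differentiable (fun t : R^o =>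
    dual_coord (vb_frame l.2 x) (g (as_add a (t *: v)))) 0.
Proof.
move=> [[/= ix jx] [oO Ox] _ sm_phi phiE].
set e := vb_frame (ab_frame i.2) x.
have eB : basis_of fullv e := vb_basis (ab_dom_sub jx).
pose y := frame_coord e (as_sub a (ab_origin i.2 x)).
pose c (t : R^o) := (ch_map i.1 x, y + t *: frame_coord e v).
pose path t := existT (fun x => A x : Type) x (as_add a (t *: v)).
have cE t : ch_map i (path t) = c t.
  congr pair => /=; rewrite as_subD; apply/rowP => n.
  by rewrite !mxE linearD linearZ.
have sm_c : Cinf setT c.
  move=> q; apply: Ck_pair; [exact: openT|exact: Ck_cst|].
  apply: (Ck_add openT (Ck_cst _ _ _)).
  apply: (Ck_scale (f := id) (g := fun=> frame_coord e v) openT).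
    exact: Ck_id.
  exact: Ck_cst.
have [oU sm] :=
  Cinf_preimage (row_pair_has_coordinates R m k) sm_c oO sm_phi.
have sm_p : Ck 1 (c @^-1` O) (fun t : R^o =>
    dual_coord (vb_frame l.2 x) (g (as_add a (t *: v)))).
  apply: (eq_Ck oU _ (Ck_snd oU (sm 1%N))) => t Ut.
  have Ut' : O (@ch_map _ _ _ (ab_charts A) i (path t)) by rewrite cE.
  have [_ pE] := phiE (path t) (conj ix jx) Ut'.
  exact: esym (congr1 snd (etrans pE (congr1 phi (cE t)))).
by apply: (proj1 sm_p); rewrite /preimage /= /c scale0r addr0; exact: Ox.
Qed.

End Fibre.

Lemma derive_row_coord (R : realType) n (p : R^o -> 'rV[R]_n) (t : R^o) l :
  differentiable p t ->
  is_derive t 1 (fun s => p s 0 l : R^o) ('D_1 p t 0 l).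
Proof.
move=> dp; have Dp : derivable p t 1 by exact: diff_derivable.
have Dpl := (derivable_mxP p t 1).1 Dp 0 l.
by apply: DeriveDef => //; rewrite derive_mx // mxE.
Qed.

(** The envelope theorem: at a point p 0 which is critical for
    q |-> F q + sum_l q_l y_l, moving p does not contribute to the derivative at
    first order, and only the dependence of y + t v on t is left. *)
Lemma derive1_envelope (R : realType) n (F : 'rV[R]_n -> R^o)
  (p : R^o -> 'rV[R]_n) (y v : 'rV[R]_n) :
  differentiable p 0 -> differentiable F (p 0) ->
  (forall q, 'd F (p 0) q + \sum_l q 0 l * y 0 l = 0) ->
  derive1 (fun t : R =>
    F (p t) + \sum_l p t 0 l * (y 0 l + t * v 0 l) : R^o) 0 =
  \sum_l v 0 l * p 0 0 l.
Proof.
move=> dp dF crit.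
have dFp : differentiable (F \o p) 0 by exact: differentiable_comp.
have D1 : is_derive (0 : R^o) 1 (F \o p) ('d F (p 0) ('D_1 p 0)).
  apply: DeriveDef; first exact: diff_derivable.
  by rewrite (deriveE _ dFp) (diff_comp dp dF) /= -(deriveE _ dp).
have D2 l : is_derive (0 : R^o) 1
    ((fun t => p t 0 l : R^o) * (fun t : R^o => y 0 l + t * v 0 l : R^o))
    ('D_1 p 0 0 l * y 0 l + v 0 l * p 0 0 l).
  have D3 : is_derive (0 : R^o) 1
      (fun t : R^o => y 0 l + t * v 0 l : R^o) (v 0 l).
    apply: is_derive_eq; rewrite scaler0 !add0r mul1r.
    exact: mulr1.
  have := is_deriveM (derive_row_coord l dp) D3.
  suff -> : p 0 0 l *: v 0 l + (y 0 l + 0 * v 0 l) *: 'D_1 p 0 0 l =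
    'D_1 p 0 0 l * y 0 l + v 0 l * p 0 0 l by [].
  by rewrite mul0r addr0 addrC [p 0 0 l *: _]mulrC [y 0 l *: _]mulrC.
have [_ DE] := is_deriveD D1 (is_derive_sum D2).
rewrite derive1E [X in 'D__ X _](_ : _ = F \o p + \sum_l
    ((fun t => p t 0 l : R^o) * (fun t : R^o => y 0 l + t * v 0 l : R^o))).
  by rewrite DE big_split addrA crit add0r.
by apply/funext => t; rewrite fctE fct_sumE.
Qed.

(** * The Legendre transform of a Hamiltonian section *)

Definition legendre_transform (R : realType) (m k : nat) (M : manifold R m)
    (V : vector_bundle M k) (A : affine_bundle V)
    (h : forall x, dual V x -> aplus A x) (g : forall x, A x -> dual V x)
    (e : {x : M & A x}) : R :=
  h (tag e) (g (tag e) (tagged e)) (tagged e).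

Section Legendre.
Variables (R : realType) (m k : nat) (M : manifold R m).
Variables (V : vector_bundle M k) (A : affine_bundle V).
Variables (h : forall x, dual V x -> aplus A x).
Variables (g : forall x, A x -> dual V x) (r : forall x, A x).
Hypothesis h_section : hamiltonian_section h.
Hypothesis g_smooth : smooth (ab_charts A) (dual_charts V) (tot g).
Hypothesis gK : forall x (a : A x), Fh h r (g a) = a.

(** The envelope theorem applies with p t the coordinates of g (a + t v), F the
    function H and y the coordinates of a - r: the point g a is critical because
    a - r is minus the gradient of H at g a. *)
Lemma fibre_differential_legendre x (a : A x) :
  fibre_differential (legendre_transform h g) a = g a.
Proof.
have [h_smooth h_mu] := h_section.
have cE := row_pair_has_coordinates R m k.
pose ea := existT (fun x => A x : Type) x a.
have [[i j] [l [U [psi hE]]]] := h_smooth (tot g ea).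
have [[/= ix jx] _ _ _ _] := hE.
have [i' [_ [_ [_ [i'x _ _ _ _]]]]] := g_smooth ea.
(* The chart (i, j) of the dual bundle serves both h at g a and g at a, so that
   H and the path t |-> g (a + t v) are read in the same frame e. *)
have [W [phi gE]] :=
  smooth_at_in_charts (j := (i, j) : ch_idx (dual_charts V)) cE cE
    (ab_atlas A) (dual_atlas V) (g_smooth ea) i'x (conj ix jx).
pose e := vb_frame j x; have eB : basis_of fullv e := vb_basis jx.
have dH := ham_coord_differentiable r hE.
suff dL v : derive1 (fun t : R => (legendre_transform h g
    (existT (fun x => A x : Type) x (as_add a (t *: v))) : R^o)) 0 = g a v.
  rewrite /fibre_differential; apply/lfunP => v.
  rewrite (_ : (fun v => _) = g a) ?lfunE //.
  exact/funext.
have dp := path_coord_differentiable v gE.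
pose p (t : R^o) := dual_coord e (g (as_add a (t *: v))).
pose y := frame_coord e (as_sub a (r x)); pose w := frame_coord e v.
have p0 : p 0 = dual_coord e (g a) by rewrite /p scale0r as_add0.
have yE : y = - frame_coord e (Fh_rel h r (g a)).
  rewrite /y -{1}(gK a) /Fh as_addK; apply/rowP => n.
  by rewrite !mxE linearN.
rewrite (dual_pairing eB) -p0.
rewrite -[RHS](@derive1_envelope _ _ (ham_coord h r e) p y w).
- congr (derive1 _ 0); apply/funext => t.
  rewrite /legendre_transform /=.
  rewrite (affine_fun_coord _ _ (r x) eB) /ham_coord dual_coordK //.
  congr (_ + _).
  apply: eq_bigr => n _; rewrite mulrC [af_lin _]h_mu; congr (_ * _).
  by rewrite as_subD !mxE linearD linearZ.
- exact: dp.
- by rewrite p0.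
move=> q; rewrite p0 -{1}(of_dual_coordK eB q) -Fh_rel_gradient //.
rewrite (dual_pairing eB) of_dual_coordK // yE -big_split big1 // => n _ /=.
by rewrite !mxE mulrN mulrC addrN.
Qed.

Lemma legendre_transform_smooth : lagrangian (legendre_transform h g).
Proof.
have [h_smooth h_mu] := h_section.
have cE := row_pair_has_coordinates R m k.
move=> ea.
have [i [j [U [phi fE]]]] := smooth_at_comp cE cE (ab_atlas A) (dual_atlas V)
  (g_smooth ea) (h_smooth (tot g ea)).
have [ix [oU Ux] sU sm_phi phiE] := fE.
have [jx _] := phiE _ ix Ux.
(* The bundles A^+ and A have charts with the same indices: j is also a chart
   of A, in which the coordinates pair as p_0 + sum_l p_l y^l. *)
have [W [T TE]] :=
  expressed_by_transition (C := ab_charts A) (j := j) (ab_atlas A) ix jx.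
have [_ [oW Wx] _ sm_T TEE] := TE.
have oUW : open (U `&` W) by exact: openI.
exists i, tt, (U `&` W),
  (fun u => (phi u).2.1 + \sum_n (T u).2 0 n * (phi u).2.2 0 n); split=> //.
- by move=> u [Uu _]; exact: sU.
- move=> q; have sub1 : U `&` W `<=` U by move=> u [].
  have sub2 : U `&` W `<=` W by move=> u [].
  have s1 := Ck_snd oUW (Ck_sub sub1 (sm_phi q)).
  have s2 := Ck_snd oUW (Ck_sub sub2 (sm_T q)).
  apply: Ck_add => //; first exact: Ck_fst oUW s1.
  apply: Ck_sum => // n.
  exact: (Ck_scale oUW (Ck_coord n oUW s2) (Ck_coord n oUW (Ck_snd oUW s1))).
move=> [y a] iy [Uy Wy]; split=> //.
have [[j1y j2y] e1] := phiE _ iy Uy; have [_ e2] := TEE _ iy Wy.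
rewrite -e1 -e2 /= /legendre_transform /=.
rewrite (affine_fun_coord _ _ (ab_origin j.2 y) (vb_basis (ab_dom_sub j2y))).
by congr (_ + _); apply: eq_bigr => n _; rewrite !mxE.
Qed.

(** Both sides are affine functions with linear part g a and with value
    L a = h (g a) a at a. *)
Lemma Leg_legendre x (a : A x) : Leg (legendre_transform h g) a = h (g a).
Proof.
have [h_smooth h_mu] := h_section.
case E : (h (g a)) => [f l fA].
have El : l = g a by rewrite -[RHS]h_mu E.
have Ef b : Leg_val (legendre_transform h g) a b = f b.
  rewrite /Leg_val fibre_differential_legendre /legendre_transform /= E /=.
  by rewrite -El -fA as_subK.
rewrite /Leg; move: (Leg_affine _ _); rewrite fibre_differential_legendre -El.
rewrite (_ : Leg_val _ a = f); last exact/funext.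
by move=> H; congr AffineFun; exact: Prop_irrelevance.
Qed.

End Legendre.

(** * The inverse Legendre transformation and the theorem *)

Lemma existT_inj2 (M : Type) (E : M -> Type) x (a b : E x) :
  existT E x a = existT E x b -> a = b.
Proof.
move=> ab; have := projT2_eq ab.
by rewrite (Prop_irrelevance (projT1_eq ab) erefl).
Qed.

(** The inverse of a bundle map over the identity of M is itself one. *)
Lemma tot_inverse (M : Type) (E E' : M -> Type)
  (f : forall x, E x -> E' x) (f' : {x : M & E' x} -> {x : M & E x}) :
  cancel (tot f) f' -> cancel f' (tot f) ->
  exists g : forall x, E' x -> E x, f' = tot g /\ forall x a, f x (g x a) = a.
Proof.
move=> fK f'K.
have lift x (a : E' x) : exists b, f x b = a.
  have := f'K (existT E' x a); case: (f' _) => y b; rewrite /tot /= => fb.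
  have yx : y = x := projT1_eq fb.
  by subst x; exists b; exact: existT_inj2 fb.
have [g gK] : exists g : forall x, E' x -> E x, forall x a, f x (g x a) = a.
  exists (fun x a => projT1 (cid (lift x a))) => x a.
  exact: (projT2 (cid (lift x a))).
exists g; split=> //; apply/funext => -[x a].
transitivity (f' (tot f (existT E x (g x a)))); first by rewrite /tot /= gK.
exact: fK.
Qed.

Theorem theorem3p6 (R : realType) (m k : nat) (M : manifold R m)
    (V : vector_bundle M k) (A : affine_bundle V) (G : lie_affgebroid A)
    (h : forall x : M, dual V x -> aplus A x)
    (h_section : hamiltonian_section h)
    (h_hyperregular : hyperregular_hamiltonian h) :
  exists (L : {x : M & A x} -> R) (hL : hyperregular_lagrangian L),
    ham_of hL = tot h.
Proof.
have [r [_ [F' [FK F'K F_smooth F'_smooth]]]] := h_hyperregular.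
have [g [F'E gK]] := tot_inverse FK F'K.
rewrite {}F'E in FK F'K F'_smooth.
pose L := legendre_transform h g.
have LegE x (a : A x) : Leg L a = h x (g x a).
  exact: (Leg_legendre h_section F'_smooth gK).
have legE : tot (@leg _ _ _ _ _ _ L) = tot g.
  apply/funext => -[x a]; apply: (congr1 (existT _ x)).
  by rewrite /leg LegE; exact: (proj2 h_section).
have hL : hyperregular_lagrangian L.
  split; first exact: (legendre_transform_smooth h_section F'_smooth).
  by rewrite legE; exists (tot (Fh h r)); split.
exists L, hL; rewrite /ham_of.
have leg_invK : cancel (leg_inv hL) (tot g).
  by rewrite -legE /leg_inv; case: cid => f [].
apply/funext => e /=.
transitivity (tot h (tot g (leg_inv hL e))); last by rewrite leg_invK.
by case: (leg_inv hL e) => x a; rewrite /tot /= LegE.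
Qed.
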